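(* Let $K$ be a compact Hausdorff space and let $X$ be a rich subspace of $C(K)$. Then for every Banach space $E$, the completed injective tensor product $X\widehat{\otimes}_{\varepsilon}E$ is a rich subspace of $C(K)\widehat{\otimes}_{\varepsilon}E$; in particular, $X\widehat{\otimes}_{\varepsilon}E$ has the Daugavet property.
   Context: Scalars are real or complex. $X\widehat{\otimes}_{\varepsilon}E$ denotes the completed injective tensor product; $C(K)\widehat{\otimes}_{\varepsilon}E$ is identified with $C(K,E)$ (continuous $E$-valued functions with sup-norm), and $X\widehat{\otimes}_{\varepsilon}E$ with the closed linear span in it of the functions $t\mapsto \psi(t)e$, $\psi\in X$, $e\in E$. A Banach space $W$ has the Daugavet property if $\|\mathrm{Id}+T\|=1+\|T\|$ for every (bounded) rank-1 operator $T\colon W\to W$. $B(W)$ is the closed unit ball and $S(W)$ the unit sphere of $W$. A slice of $B(W)$ is a nonvoid set of the form $\{w\in B(W): \operatorname{Re} w^*(w)>\alpha\}$ with $w^*\in W^*$, $\alpha\in\mathbb{R}$. An operator $T\colon W\to V$ between Banach spaces is narrow if for every $x,y\in S(W)$, every $\delta>0$ and every slice $S$ of $B(W)$ containing $y$ there is $v\in S$ with $\|x+v\|>2-\delta$ and $\|T(y-v)\|<\delta$. A closed subspace $Z$ of $W$ is rich in $W$ if the quotient map $q\colon W\to W/Z$ is narrow. *)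

(* Defs.v *)
From HB Require Import structures.
From mathcomp Require Import all_boot all_order all_algebra ring_quotient.
From mathcomp Require Import complex.
From mathcomp Require Import all_classical all_reals all_analysis.

Set Implicit Arguments.
Unset Strict Implicit.
Unset Printing Implicit Defensive.

Import Order.TTheory GRing.Theory Num.Theory.
Import numFieldNormedType.Exports.

Local Open Scope classical_set_scope.
Local Open Scope ring_scope.

Variant scalar_kind := RealScalars | ComplexScalars.

Definition scalars (R : realType) (k : scalar_kind) : numFieldType :=
  match k with
  | RealScalars => R
  | ComplexScalars => R[i]
  end.

Definition re {R : realType} {k : scalar_kind} : scalars R k -> R :=
  match k return scalars R k -> R with
  | RealScalars => fun x => x
  | ComplexScalars => @complex.Re R
  end.

Definition ofR {R : realType} {k : scalar_kind} : R -> scalars R k :=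
  match k return R -> scalars R k with
  | RealScalars => fun x => x
  | ComplexScalars => fun x => (x%:C)%C
  end.

Section scalar_theory.
Context {R : realType} {k : scalar_kind}.
Implicit Types (a b : R) (z : scalars R k).

Lemma ofRK : cancel (@ofR R k) re. Proof. by case: k. Qed.

Lemma re_ofR z : 0 <= z -> ofR (re z) = z.
Proof.
case: k z => //= z z0; rewrite -[LHS]/(_%:C)%C.
by rewrite RRe_real // ger0_real.
Qed.

Lemma ler_ofR a b : ((ofR a : scalars R k) <= ofR b) = (a <= b).
Proof. by case: k => //=; rewrite lecR. Qed.

Lemma ltr_ofR a b : ((ofR a : scalars R k) < ofR b) = (a < b).
Proof. by rewrite !lt_def ler_ofR (can_eq ofRK). Qed.

Lemma ofR0 : ofR 0 = 0 :> scalars R k. Proof. by case: k. Qed.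

Lemma ofRD a b : ofR (a + b) = ofR a + ofR b :> scalars R k.
Proof. by case: k => //=; rewrite rmorphD. Qed.

Lemma ofRM a b : ofR (a * b) = ofR a * ofR b :> scalars R k.
Proof. by case: k => //=; rewrite rmorphM. Qed.

End scalar_theory.

(* The library's norm takes its values in the field of scalars;
   [nrm] is the same number, as an element of [R]. *)
Definition nrm {R : realType} {k : scalar_kind}
  {V : normedModType (scalars R k)} (x : V) : R := re `|x|.

Section nrm_theory.
Context {R : realType} {k : scalar_kind} {V : normedModType (scalars R k)}.
Implicit Types x y : V.

Lemma normrE x : `|x| = ofR (nrm x).
Proof. by rewrite re_ofR. Qed.

Lemma nrm_ge0 x : 0 <= nrm x.
Proof. by rewrite -(@ler_ofR R k) -normrE ofR0. Qed.

Lemma nrm0 : nrm (0 : V) = 0.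
Proof. by rewrite /nrm normr0 -[X in re X]ofR0 ofRK. Qed.

Lemma ler_nrmD x y : nrm (x + y) <= nrm x + nrm y.
Proof. by rewrite -(@ler_ofR R k) ofRD -!normrE ler_normD. Qed.

Lemma nrmZ (a : scalars R k) x : nrm (a *: x) = re `|a| * nrm x.
Proof.
apply: (can_inj (@ofRK R k)).
by rewrite ofRM -!normrE normrZ re_ofR.
Qed.

Lemma nrm0_eq0 x : nrm x = 0 -> x = 0.
Proof. by move=> x0; apply/eqP; rewrite -normr_eq0 normrE x0 ofR0. Qed.

Lemma nrmN x : nrm (- x) = nrm x. Proof. by rewrite /nrm normrN. Qed.

Lemma closureP_nrm (A : set V) x :
  closure A x <-> forall e : R, 0 < e -> exists2 y, A y & nrm (x - y) < e.
Proof.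
split=> [clA e e0|H B].
  have e0' : (0 : scalars R k) < ofR e by rewrite -ofR0 ltr_ofR.
  have /clA[y [Ay]] : nbhs x (ball x (ofR e : scalars R k)) by exact: nbhsx_ballx.
  by rewrite -ball_normE /ball_/= normrE ltr_ofR => ?; exists y.
move=> /nbhs_ballP[e /= e0]; rewrite -ball_normE => eB.
have e0' : 0 < re e by rewrite -(@ltr_ofR R k) ofR0 re_ofR // ltW.
have [y Ay yx] := H _ e0'; exists y; split => //; apply: eB => /=.
by rewrite normrE -(re_ofR (ltW e0)) ltr_ofR.
Qed.

End nrm_theory.

(* This is the operator norm only for bounded [T]: [sup] is 0 on unbounded
   sets. *)
Definition opnorm {R : realType} {k : scalar_kind}
    {V W : normedModType (scalars R k)} (T : V -> W) : R :=
  sup [set nrm (T v) | v in [set v : V | nrm v <= 1]].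

(* Rank exactly 1: the null operator is excluded, so that the space {0} has the
   Daugavet property. *)
Definition rank1 {R : realType} {k : scalar_kind}
    {V W : normedModType (scalars R k)} (T : V -> W) : Prop :=
  exists2 w : W, w != 0 & range T = range (fun a : scalars R k => a *: w).

Definition daugavet {R : realType} {k : scalar_kind}
    (W : normedModType (scalars R k)) : Prop :=
  forall T : {linear W -> W}, continuous T -> rank1 T ->
    opnorm (fun w => w + T w) = 1 + opnorm T.

Definition slice {R : realType} {k : scalar_kind}
    {W : normedModType (scalars R k)} (S : set W) : Prop :=
  S !=set0 /\
  exists (f : {linear W -> (scalars R k)^o}) (alpha : R),
    continuous f /\ S = [set w | nrm w <= 1 /\ alpha < re (f w)].

Definition narrow {R : realType} {k : scalar_kind}
    {W V : normedModType (scalars R k)} (T : {linear W -> V}) : Prop :=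
  forall x y : W, nrm x = 1 -> nrm y = 1 ->
  forall delta : R, 0 < delta ->
  forall S : set W, slice S -> S y ->
  exists v : W, [/\ S v, 2 - delta < nrm (x + v) & nrm (T (y - v)) < delta].

Record closed_subspace {R : realType} {k : scalar_kind}
    (W : normedModType (scalars R k)) := ClosedSubspace {
  cs_set :> set W ;
  cs_submod : submod_closed (fun w : W => `[< cs_set w >]) ;
  cs_closed : closed cs_set
}.

Section closed_subspaces.
Context {R : realType} {k : scalar_kind} {W : normedModType (scalars R k)}.
Variable Z : closed_subspace W.

Definition cs_pred : {pred W} := fun w => `[< cs_set Z w >].

HB.instance Definition _ :=
  GRing.isSubmodClosed.Build (scalars R k) W cs_pred (cs_submod Z).

Lemma cs_predE w : (w \in cs_pred) = `[< cs_set Z w >]. Proof. by []. Qed.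

Record normed_subspace := NormedSubspace {
  subspace_val :> W ;
  _ : subspace_val \in cs_pred
}.

HB.instance Definition _ := [isSub for subspace_val].
HB.instance Definition _ := [Choice of normed_subspace by <:].
HB.instance Definition _ := [SubChoice_isSubLmodule of normed_subspace by <:].

Let snorm (z : normed_subspace) : scalars R k := `|subspace_val z|.

Let snormD x y : snorm (x + y) <= snorm x + snorm y.
Proof. exact: ler_normD. Qed.
Let snormZ a x : snorm (a *: x) = `|a| * snorm x.
Proof. exact: normrZ. Qed.
Let snorm_eq0 x : snorm x = 0 -> x = 0.
Proof. by move=> /normr0_eq0 x0; apply: val_inj. Qed.

HB.instance Definition _ :=
  Lmodule_isNormed.Build (scalars R k) normed_subspace snormD snormZ snorm_eq0.

Definition normed_quotient : Type := Quotient.quot cs_pred.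

HB.instance Definition _ :=
  GRing.Zmodule.copy normed_quotient (Quotient.quot cs_pred).

Definition quotient_map (w : W) : normed_quotient :=
  (\pi_(Quotient.quot cs_pred) w)%qT.

Lemma quotient_mapE x y : (quotient_map x = quotient_map y) <-> cs_set Z (x - y).
Proof.
rewrite /quotient_map (rwP eqP) -Quotient.idealrBE cs_predE.
by split=> /asboolP.
Qed.

Lemma quotient_map_surj q : exists w, quotient_map w = q.
Proof. by exists (repr (q : Quotient.quot cs_pred)); exact: reprK. Qed.

Lemma quotient_mapB : zmod_morphism quotient_map.
Proof. by move=> x y; exact: (raddfB (\pi_(Quotient.quot cs_pred)%qT)). Qed.

Let qscale (a : scalars R k) (q : normed_quotient) : normed_quotient :=
  quotient_map (a *: repr (q : Quotient.quot cs_pred)).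

Let qscaleE a w : qscale a (quotient_map w) = quotient_map (a *: w).
Proof.
apply/quotient_mapE; rewrite -scalerBr.
have : cs_set Z (repr (quotient_map w : Quotient.quot cs_pred) - w).
  by apply/quotient_mapE; exact: reprK.
by move=> /asboolP /(rpredZ a (s := cs_pred)) /asboolP.
Qed.

Let qD x y : quotient_map (x + y) = quotient_map x + quotient_map y.
Proof. exact: (raddfD (\pi_(Quotient.quot cs_pred)%qT)). Qed.

Let qscaleA a b q : qscale a (qscale b q) = qscale (a * b) q.
Proof.
by have [w <-] := quotient_map_surj q; rewrite !qscaleE scalerA.
Qed.
Let qscale1 : left_id 1 qscale.
Proof.
by move=> q; have [w <-] := quotient_map_surj q; rewrite !qscaleE scale1r.
Qed.
Let qscaleDr : right_distributive qscale +%R.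
Proof.
move=> a p q; have [v <-] := quotient_map_surj p.
have [w <-] := quotient_map_surj q.
by rewrite -qD !qscaleE scalerDr qD.
Qed.
Let qscaleDl q : {morph qscale^~ q : a b / a + b}.
Proof.
move=> a b; have [w <-] := quotient_map_surj q.
by rewrite !qscaleE scalerDl qD.
Qed.

HB.instance Definition _ := GRing.Zmodule_isLmodule.Build (scalars R k) normed_quotient
  qscaleA qscale1 qscaleDr qscaleDl.

Lemma quotient_mapZ : scalable quotient_map.
Proof. by move=> a w; rewrite -qscaleE. Qed.

HB.instance Definition _ :=
  GRing.isZmodMorphism.Build W normed_quotient quotient_map quotient_mapB.
HB.instance Definition _ :=
  GRing.isScalable.Build (scalars R k) W normed_quotient *:%R quotient_map quotient_mapZ.

Definition quotient_nrm (q : normed_quotient) : R :=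
  inf [set nrm w | w in [set w | quotient_map w = q]].

Lemma quotient_nrm_ge0 q : 0 <= quotient_nrm q.
Proof.
apply: lb_le_inf; last by move=> _ [w _ <-]; exact: nrm_ge0.
by have [w wq] := quotient_map_surj q; exists (nrm w), w.
Qed.

Lemma quotient_nrm_le w : quotient_nrm (quotient_map w) <= nrm w.
Proof.
by apply: ge_inf; [exists 0 => _ [v _ <-]; exact: nrm_ge0 | exists w].
Qed.

Lemma quotient_nrm_lt q (e : R) : 0 < e ->
  exists2 w, quotient_map w = q & nrm w < quotient_nrm q + e.
Proof.
move=> e0; have [|_ [w wq <-] ?] := @inf_adherent _
  [set nrm w | w in [set w | quotient_map w = q]] e e0; last by exists w.
split; last by exists 0 => _ [v _ <-]; exact: nrm_ge0.
by have [w wq] := quotient_map_surj q; exists (nrm w), w.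
Qed.

Let qnorm (q : normed_quotient) : scalars R k := ofR (quotient_nrm q).

Let qnormD p q : qnorm (p + q) <= qnorm p + qnorm q.
Proof.
rewrite -ofRD ler_ofR; apply/ler_addgt0Pr => e e0.
have e2 : 0 < e / 2 by rewrite divr_gt0.
have [v <- vp] := quotient_nrm_lt p e2; have [w <- wq] := quotient_nrm_lt q e2.
rewrite -qD (le_trans (quotient_nrm_le _))// (le_trans (ler_nrmD _ _))//.
by rewrite [e]splitr addrACA lerD// ltW.
Qed.

Let quotient_nrmZ_le a q : quotient_nrm (a *: q) <= re `|a| * quotient_nrm q.
Proof.
have a0 : 0 <= re `|a| by rewrite -(@ler_ofR R k) ofR0 re_ofR.
apply/ler_addgt0Pr => e e0.
have d0 : 0 < e / (re `|a| + 1) by rewrite divr_gt0// ltr_wpDl.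
have [w <- wq] := quotient_nrm_lt q d0.
rewrite -quotient_mapZ (le_trans (quotient_nrm_le _))// nrmZ.
rewrite (le_trans (ler_wpM2l a0 (ltW wq)))// mulrDr lerD2l mulrCA.
by rewrite ger_pMr// ler_pdivrMr ?ltr_wpDl// mul1r lerDl.
Qed.

Let qnormZ a q : qnorm (a *: q) = `|a| * qnorm q.
Proof.
rewrite -[`|a|]re_ofR// -ofRM /qnorm; congr ofR; apply/le_anti.
rewrite quotient_nrmZ_le/=; have [->|a0] := eqVneq a 0.
  by rewrite normr0 -[X in re X]ofR0 ofRK mul0r quotient_nrm_ge0.
have ra0 : 0 <= re `|a| by rewrite -(@ler_ofR R k) ofR0 re_ofR.
have := ler_wpM2l ra0 (quotient_nrmZ_le a^-1 (a *: q)).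
rewrite scalerA mulVf// scale1r => /le_trans; apply.
have aV : re `|a| * re `|a^-1| = 1.
  apply: (can_inj (@ofRK R k)).
  rewrite ofRM !re_ofR// -normrM divff// normr1.
  by case: k.
by rewrite mulrA aV mul1r.
Qed.

Let qnorm_eq0 q : qnorm q = 0 -> q = 0.
Proof.
rewrite -(ofR0 (k := k)) => /(can_inj (@ofRK R k)) q0.
have [w wq] := quotient_map_surj q.
rewrite -wq -[RHS](raddf0 quotient_map); apply/quotient_mapE; rewrite subr0.
apply/(@cs_closed _ _ _ Z)/closureP_nrm => e e0.
have [v vq] := quotient_nrm_lt q e0; rewrite q0 add0r => ve.
exists (w - v); first by apply/quotient_mapE; rewrite vq.
by rewrite opprB addrC subrK.
Qed.

HB.instance Definition _ :=
  Lmodule_isNormed.Build (scalars R k) normed_quotient qnormD qnormZ qnorm_eq0.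

Lemma nrm_quotient q :
  nrm q = inf [set nrm w | w in [set w | quotient_map w = q]].
Proof. exact: ofRK. Qed.

Lemma quotient_map_continuous : continuous quotient_map.
Proof.
move=> w; apply/cvgrPdist_lt => e e0.
have /cvgrPdist_lt/(_ e e0) : x @[x --> w] --> w by exact: cvg_id.
apply: filterS => v; apply: le_lt_trans.
by rewrite -quotient_mapB !normrE ler_ofR nrm_quotient quotient_nrm_le.
Qed.

End closed_subspaces.

Arguments normed_subspace {R k W} Z.
Arguments normed_quotient {R k W} Z.
Arguments quotient_map {R k W} Z _.

Definition rich {R : realType} {k : scalar_kind}
    {W : normedModType (scalars R k)} (Z : closed_subspace W) : Prop :=
  narrow (quotient_map Z).

Section closed_span.
Context {R : realType} {k : scalar_kind} {W : normedModType (scalars R k)}.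
Implicit Type A : set W.

Definition lin_span A : set W := [set w | exists s : seq (scalars R k * W),
  (forall p, p \in s -> A p.2) /\ w = \sum_(p <- s) p.1 *: p.2].

Lemma closed_span_submod A :
  submod_closed (fun w : W => `[< closure (lin_span A) w >]).
Proof.
split=> [|a u v /asboolP/closureP_nrm Au /asboolP/closureP_nrm Av].
  apply/asboolP/subset_closure; exists [::]; split=> //.
  by rewrite big_nil.
apply/asboolP/closureP_nrm => e e0.
have a0 : 0 <= re `|a| by rewrite -(@ler_ofR R k) ofR0 re_ofR.
have d0 : 0 < e / 2 / (re `|a| + 1) by rewrite !divr_gt0// ltr_wpDl.
have [_ [s [sA ->]] us] := Au _ d0.
have [_ [t [tA ->]] vt] := Av _ (divr_gt0 e0 (ltr0Sn _ 1)).
exists (a *: (\sum_(p <- s) p.1 *: p.2) + \sum_(p <- t) p.1 *: p.2).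
  exists ([seq (a * p.1, p.2) | p <- s] ++ t); split=> [p|].
    rewrite mem_cat => /orP[/mapP[q qs ->]|]; first exact: (sA q qs).
    exact: tA.
  rewrite big_cat/= big_map scaler_sumr; congr (_ + _).
  by apply: eq_bigr => p _; rewrite scalerA.
rewrite opprD addrACA -scalerBr (le_lt_trans (ler_nrmD _ _))// nrmZ.
rewrite [e]splitr ler_ltD// (le_trans (ler_wpM2l a0 (ltW us)))// mulrCA.
by rewrite ger_pMr ?divr_gt0// ler_pdivrMr ?ltr_wpDl// mul1r lerDl.
Qed.

Definition closed_span A : closed_subspace W :=
  ClosedSubspace (closed_span_submod A) (@closed_closure _ (lin_span A)).

End closed_span.

HB.mixin Record isCompactHausdorff T & Topological T := {
  compactT : compact [set: T] ;
  hausdorffT : hausdorff_space T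
}.

#[short(type="compactHausdorffType")]
HB.structure Definition CompactHausdorff :=
  {T of Topological T & isCompactHausdorff T}.

Section contfun.
Context {R : realType} {k : scalar_kind}.
Variables (K : compactHausdorffType) (E : normedModType (scalars R k)).

Definition continuous_pred : {pred (K -> E)} := fun f => `[< continuous f >].

Lemma continuous_submod : submod_closed continuous_pred.
Proof.
split=> [|a f g /asboolP cf /asboolP cg]; apply/asboolP => t.
  exact: cvg_cst.
by apply: cvgD; [apply: cvgZ; [exact: cvg_cst|exact: cf]|exact: cg].
Qed.

HB.instance Definition _ := GRing.isSubmodClosed.Build (scalars R k) (K -> E)
  continuous_pred continuous_submod.

Record contfun := ContFun {
  contfun_val :> K -> E ;
  _ : contfun_val \in continuous_pred
}.

HB.instance Definition _ := [isSub for contfun_val].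
HB.instance Definition _ := [Choice of contfun by <:].
HB.instance Definition _ := [SubChoice_isSubLmodule of contfun by <:].

Lemma contfun_continuous (f : contfun) : continuous f.
Proof. by have /asboolP := valP f. Qed.

(* When [K] is empty the range is empty, and [sup set0 = 0]. *)
Definition sup_nrm (f : contfun) : R := sup (range (fun t => nrm (f t))).

Lemma contfun_bounded (f : contfun) : exists M, forall t, nrm (f t) <= M.
Proof.
have /compact_near_coveringP/(_ _ +oo%R (fun M t => nrm (f t) <= M)) :=
  @compactT K.
case=> [t _|M0 [_ fM]]; last first.
  by exists (M0 + 1) => t; apply: fM => //; rewrite ltrDl.
exists ([set s | nrm (f s) < nrm (f t) + 1], [set M | nrm (f t) + 1 < M]).
  split=> /=; last by exists (nrm (f t) + 1); split => //; exact: num_real.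
  have : `|f t| < ofR (nrm (f t) + 1) by rewrite normrE ltr_ofR ltrDl.
  move=> /(cvgr_norm_lt _ (@contfun_continuous f t)).
  by apply: filterS => s; rewrite normrE ltr_ofR.
by move=> [s M] /= [fs tM]; exact: ltW (lt_trans fs tM).
Qed.

Lemma nrm_le_sup (f : contfun) t : nrm (f t) <= sup_nrm f.
Proof.
apply: ub_le_sup; last by exists t.
by have [M fM] := contfun_bounded f; exists M => _ [s _ <-].
Qed.

Lemma sup_nrm_ge0 (f : contfun) : 0 <= sup_nrm f.
Proof.
have [[t _]|/set0P/negP/negPn/eqP K0] := pselect ([set: K] !=set0).
  exact: le_trans (nrm_ge0 _) (nrm_le_sup f t).
by rewrite /sup_nrm K0 image_set0 sup0.
Qed.

Lemma sup_nrm_le (f : contfun) (M : R) :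
  0 <= M -> (forall t, nrm (f t) <= M) -> sup_nrm f <= M.
Proof.
move=> M0 fM; have [[t _]|/set0P/negP/negPn/eqP K0] := pselect ([set: K] !=set0).
  by apply: ge_sup; [exists (nrm (f t)), t | move=> _ [s _ <-]].
by rewrite /sup_nrm K0 image_set0 sup0.
Qed.

Let cnorm (f : contfun) : scalars R k := ofR (sup_nrm f).

Let cnormD f g : cnorm (f + g) <= cnorm f + cnorm g.
Proof.
rewrite -ofRD ler_ofR; apply: sup_nrm_le => [|t].
  by rewrite addr_ge0// sup_nrm_ge0.
by rewrite (le_trans (ler_nrmD _ _))// lerD// nrm_le_sup.
Qed.

Let cnormZ a f : cnorm (a *: f) = `|a| * cnorm f.
Proof.
rewrite -[`|a|]re_ofR// -ofRM; congr ofR.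
have a0 : 0 <= re `|a| by rewrite -(@ler_ofR R k) ofR0 re_ofR.
apply/le_anti/andP; split.
  apply: sup_nrm_le => [|t]; first by rewrite mulr_ge0// sup_nrm_ge0.
  by rewrite nrmZ ler_wpM2l// nrm_le_sup.
have [<-|a1] : 0 = re `|a| \/ 0 < re `|a| by apply/predU1P; rewrite -le_eqVlt.
  by rewrite mul0r sup_nrm_ge0.
rewrite mulrC -ler_pdivlMr//; apply: sup_nrm_le => [|t].
  by rewrite divr_ge0// sup_nrm_ge0.
by rewrite ler_pdivlMr// mulrC -nrmZ (nrm_le_sup (a *: f)).
Qed.

Let cnorm_eq0 f : cnorm f = 0 -> f = 0.
Proof.
rewrite -(ofR0 (k := k)) => /(can_inj (@ofRK R k)) f0.
apply/val_inj/funext => t; apply/nrm0_eq0/le_anti.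
by rewrite nrm_ge0 andbT -f0 (nrm_le_sup f).
Qed.

HB.instance Definition _ :=
  Lmodule_isNormed.Build (scalars R k) contfun cnormD cnormZ cnorm_eq0.

Lemma nrm_contfun (f : contfun) : nrm f = sup (range (fun t => nrm (f t))).
Proof. exact: ofRK. Qed.

End contfun.

Section inj_tensor.
Context {R : realType} {k : scalar_kind} {K : compactHausdorffType}.
Local Notation CK := (contfun K (scalars R k)^o).

Lemma elem_tensor_subproof (E : normedModType (scalars R k)) (psi : CK) (e : E) :
  (fun t => (psi t : scalars R k) *: e) \in @continuous_pred R k K E.
Proof.
apply/asboolP => t; apply: cvgZ; last exact: cvg_cst.
exact: (@contfun_continuous _ _ _ _ psi).
Qed.

Definition elem_tensor (E : normedModType (scalars R k)) (psi : CK) (e : E) :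
  contfun K E := ContFun (elem_tensor_subproof psi e).

(* The injective tensor norm on the algebraic tensor product of [X] and [E] is
   the sup norm of [C(K, E)], so its completion is identified with a closed
   linear span. *)
Definition inj_tensor (X : closed_subspace CK) (E : normedModType (scalars R k)) :
    closed_subspace (contfun K E) :=
  closed_span
    [set h | exists psi e, cs_set X psi /\ h = elem_tensor psi e].

End inj_tensor.

(* Main.v *)
(* Richness of [X] alone yields, for every nonempty open [U], a function
   [0 <= p <= 1] supported in [U], with values close to [1], and almost in [X]:
   push a function of the unit ball upwards again and again on smaller and
   smaller open sets; the corrections outside these sets telescope, so that the
   average of the increments is almost nonnegative and almost vanishes off [U].
   Since [K] has no isolated points, many such bumps with disjoint supports
   exist, hence [p] can be chosen almost in the kernel of a given functional.
   Given [x] and [y] in the unit ball of [C(K, E)], almost constant on [U], with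
   [x] close to a unit vector [e] there, the function [v = (1 - p) y + p e] is in
   the unit ball, [x + v] has norm close to [2], and [v - y = p (e - y)] is close
   to the elementary tensor of an element of [X] and [e - y(t0)].  Taking [x] and
   [y] in the tensor product and [v] close to it, with [x] proportional to [T y],
   gives the Daugavet equation without extending functionals. *)

From HB Require Import structures.
Require Import Defs.
From mathcomp Require Import all_boot all_order all_algebra.
From mathcomp Require Import complex ring lra.
From mathcomp Require Import all_classical all_reals all_analysis.

Set Implicit Arguments.
Unset Strict Implicit.
Unset Printing Implicit Defensive.

Import Order.TTheory GRing.Theory Num.Theory.
Import numFieldNormedType.Exports.

Local Open Scope classical_set_scope.
Local Open Scope ring_scope.

(** * Norms and real parts of real or complex scalars *)

Lemma nrm_complexE {R : realType} (z : (scalars R ComplexScalars)^o) :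
  nrm z = Num.sqrt (complex.Re z ^+ 2 + complex.Im z ^+ 2).
Proof. exact: (congr1 (@complex.Re R) (normc_def z)). Qed.

Section scalars_nrm.
Context {R : realType} {k : scalar_kind}.
Local Notation F := (scalars R k).

Lemma ofR1 : ofR 1 = 1 :> F. Proof. by case: k. Qed.

Lemma ofRN (a : R) : ofR (- a) = - ofR a :> F.
Proof. by case: k => //=; rewrite rmorphN. Qed.

Lemma ofRB (a b : R) : ofR (a - b) = ofR a - ofR b :> F.
Proof. by rewrite ofRD ofRN. Qed.

Lemma reN (z : F) : re (- z) = - re z.
Proof. by case: k z => //= -[]. Qed.

Lemma reD (z z' : F) : re (z + z') = re z + re z'.
Proof. by case: k z z' => //= -[? ?] []. Qed.

Lemma re0 : re (0 : F) = 0. Proof. by case: k. Qed.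

Lemma re_norm_ofR (a : R) : re `|ofR a : F| = `|a|.
Proof.
have [a0|/ltW a0] := leP 0 a.
  by rewrite !ger0_norm ?ofRK // -ofR0 ler_ofR.
by rewrite !ler0_norm -?ofRN ?ofRK // -ofR0 ler_ofR.
Qed.

Lemma nrmZ_ofR {V : normedModType F} (a : R) (v : V) :
  nrm (ofR a *: v) = `|a| * nrm v.
Proof. by rewrite nrmZ re_norm_ofR. Qed.

Lemma nrm_ofR (a : R) : nrm (ofR a : F^o) = `|a|.
Proof. exact: re_norm_ofR. Qed.

Lemma re_le_nrm (z : F^o) : re z <= nrm z.
Proof.
case: k z => [z|[a b]]; first exact: ler_norm.
rewrite nrm_complexE (le_trans (ler_norm _))// -sqrtr_sqr.
by rewrite ler_wsqrtr// lerDl sqr_ge0.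
Qed.

Lemma nrm_add1_sqr (z : F^o) :
  nrm ((1 : F^o) + z) ^+ 2 = 1 + 2 * re z + nrm z ^+ 2.
Proof.
case: k z => [z|[a b]].
  change (`|1 + z| ^+ 2 = 1 + 2 * z + `|z| ^+ 2).
  by rewrite !real_normK ?num_real//; ring.
rewrite !nrm_complexE /= !sqr_sqrtr ?addr_ge0 ?sqr_ge0//; ring.
Qed.

(** It turns [1 + z] of norm close to [2] into [z] close to [1], uniformly for real and complex
    scalars. *)
Lemma nrm_parallelogram1 (z : F^o) :
  nrm ((1 : F^o) + z) ^+ 2 + nrm (z - (1 : F^o)) ^+ 2 = 2 + 2 * nrm z ^+ 2.
Proof.
rewrite -[nrm (z - _)]nrmN opprB !nrm_add1_sqr nrmN reN; ring.
Qed.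

End scalars_nrm.

Section nrm_extra.
Context {R : realType} {k : scalar_kind}.
Local Notation F := (scalars R k).

Lemma ler_nrmB {V : normedModType F} (x y : V) : nrm (x - y) <= nrm x + nrm y.
Proof. by rewrite (le_trans (ler_nrmD _ _))// nrmN. Qed.

Lemma ler_dist_nrm {V : normedModType F} (x y : V) :
  nrm x <= nrm y + nrm (x - y).
Proof. by rewrite -{1}(subrK y x) addrC ler_nrmD. Qed.

Lemma nrm_eq0 {V : normedModType F} (x : V) : (nrm x == 0) = (x == 0).
Proof. by apply/eqP/eqP => [/nrm0_eq0|->]//; rewrite nrm0. Qed.

Lemma nrm_gt0 {V : normedModType F} (x : V) : (0 < nrm x) = (x != 0).
Proof. by rewrite lt_def nrm_ge0 nrm_eq0 andbT. Qed.

Lemma continuous_linear_nrm {V W : normedModType F} (T : {linear V -> W}) :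
  continuous T -> exists2 C : R, 0 < C & forall v, nrm (T v) <= C * nrm v.
Proof.
move=> /linear_bounded_continuous/linear_boundedP/pinfty_ex_gt0[r r0 Tr].
exists (re r) => [|v]; first by rewrite -(@ltr_ofR R k) ofR0 re_ofR// ltW.
by rewrite -(@ler_ofR R k) ofRM -!Defs.normrE re_ofR; [exact: Tr|exact: ltW].
Qed.

End nrm_extra.

(** * Continuous functions on [K]: pointwise operations, sup norm, Urysohn functions *)

Section contfun_extra.
Context {R : realType} {k : scalar_kind} {K : compactHausdorffType}.
Local Notation F := (scalars R k).

Lemma continuous_ofR : continuous (@ofR R k : R -> F).
Proof.
move=> a; apply/cvgrPdist_lt => e e0.
have e0' : 0 < re e by rewrite -(@ltr_ofR R k) ofR0 re_ofR// ltW.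
have /cvgrPdist_lt/(_ _ e0') : x @[x --> a] --> a by exact: cvg_id.
apply: filterS => b; rewrite -ofRB.
rewrite -(@ltr_ofR R k) -(re_norm_ofR (k := k)) !re_ofR//.
exact: ltW.
Qed.

Context {E : normedModType F}.

Lemma contfun_eq (f g : contfun K E) :
  (forall t, f t = g t) -> f = g.
Proof. by move=> fg; apply/val_inj/funext. Qed.

Lemma contfunD (f g : contfun K E) t : (f + g) t = f t + g t.
Proof. by []. Qed.

Lemma contfunN (f : contfun K E) t : (- f) t = - f t.
Proof. by []. Qed.

Lemma contfunZ a (f : contfun K E) t : (a *: f) t = a *: f t.
Proof. by []. Qed.

Lemma nrm_contfun_le (f : contfun K E) (M : R) :
  0 <= M -> (forall t, nrm (f t) <= M) -> nrm f <= M.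
Proof. rewrite nrm_contfun; exact: sup_nrm_le. Qed.

Lemma nrm_apply_le (f : contfun K E) t : nrm (f t) <= nrm f.
Proof. rewrite nrm_contfun; exact: nrm_le_sup. Qed.

Lemma nrm_contfun_gt (f : contfun K E) (M : R) :
  0 <= M -> M < nrm f -> exists t, M < nrm (f t).
Proof.
move=> M0; apply: contraPP => /forallNP fM; apply/negP; rewrite -leNgt.
by apply: nrm_contfun_le => // t; rewrite leNgt; exact/negP/fM.
Qed.

Lemma open_nrm_lt (f : contfun K E) (c : E) (M : R) : open [set t | nrm (f t - c) < M].
Proof.
rewrite openE => t /= ftM; rewrite /interior/=.
have : `|f t - c| < ofR M by rewrite Defs.normrE ltr_ofR.
have fc : f s - c @[s --> t] --> f t - c.
  by apply: cvgB; [exact: contfun_continuous|exact: cvg_cst].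
move=> /(cvgr_norm_lt _ fc).
by apply: filterS => s; rewrite Defs.normrE ltr_ofR.
Qed.

Lemma rmul_subproof (p : K -> R) (cp : continuous p) (f : contfun K E) :
  (fun t => (ofR (p t) : F) *: f t) \in @continuous_pred R k K E.
Proof.
apply/asboolP => t; apply: cvgZ; last exact: contfun_continuous.
have pt : ofR (p s) @[s --> t] --> (ofR (p t) : F).
  apply: (@cvg_comp _ _ _ p ofR _ (nbhs (p t))); first exact: cp.
  exact: continuous_ofR.
exact: pt.
Qed.

Definition rmul (p : K -> R) (cp : continuous p) (f : contfun K E) :
  contfun K E := ContFun (rmul_subproof cp f).

Lemma rmulE p (cp : continuous p) (f : contfun K E) t :
  rmul cp f t = ofR (p t) *: f t.
Proof. by []. Qed.

Lemma cst_contfun_subproof (e : E) :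
  (fun _ => e) \in @continuous_pred R k K E.
Proof. by apply/asboolP => t; exact: cvg_cst. Qed.

Definition cst_contfun (e : E) : contfun K E := ContFun (cst_contfun_subproof e).

Lemma nrm_cst_contfun (e : E) (t0 : K) :
  nrm (cst_contfun e : contfun K E) = nrm e.
Proof.
apply/le_anti/andP; split; first by apply: nrm_contfun_le; rewrite ?nrm_ge0.
exact: (nrm_apply_le (cst_contfun e) t0).
Qed.

End contfun_extra.

Section subval.
Context {R : realType} {k : scalar_kind} {K : compactHausdorffType}.
Context {E : normedModType (scalars R k)} {Z : closed_subspace (contfun K E)}.

(* The coercion [subspace_val] only lands in the carrier of a normed module;
   [subval] makes its values applicable as functions on [K]. *)
Definition subval (g : normed_subspace Z) : contfun K E := subspace_val g.

Lemma subvalD f g : subval (f + g) = subval f + subval g.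
Proof. by []. Qed.

Lemma subvalZ a g : subval (a *: g) = a *: subval g.
Proof. by []. Qed.

Lemma nrm_subvalZB (a : R) (g : normed_subspace Z) (f : contfun K E) :
  nrm (subval (ofR a *: g) - ofR a *: f) = `|a| * nrm (subval g - f).
Proof. by rewrite subvalZ -scalerBr nrmZ_ofR. Qed.

End subval.

Lemma urysohn_bump {R : realType} {K : compactHausdorffType} (U : set K) (t0 : K) :
  open U -> U t0 -> exists s : K -> R,
  [/\ continuous s, forall t, 0 <= s t <= 1, s t0 = 1 & forall t, ~ U t -> s t = 0].
Proof.
move=> oU Ut0.
have /(uniform_separatorP (R := R)) : uniform_separator (~` U) [set t0].
  apply: (proj1 (normal_separatorP (R := R)) (compact_normal hausdorffT compactT)).
  - exact: open_closedC.
  - exact/accessible_closed_set1/hausdorff_accessible/hausdorffT.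
  - by apply/disjoints_subset => t nUt /= tt0; apply: nUt; rewrite tt0.
case=> s [cs s01 s0 s1]; exists s; split => //.
- move=> t; have : range s (s t) by exists t.
  by move=> /s01/=; rewrite in_itv.
- exact: (s1 _ (ex_intro2 _ _ t0 erefl erefl)).
- by move=> t nUt; apply: s0; exists t.
Qed.

(** * Approximation by elements of a rich subspace *)

Section rich_subspaces.
Context {R : realType} {k : scalar_kind}.
Local Notation F := (scalars R k).

Lemma slice_ball (W : normedModType F) : slice [set w : W | nrm w <= 1].
Proof.
split; first by exists 0; rewrite /= nrm0.
exists (GRing.null_fun _ : {linear W -> F^o}), (-1); split.
  by move=> x; exact: cvg_cst.
apply/seteqP; split=> w /=; last by case.
by split=> //; rewrite re0 ltrN10.
Qed.

(** Narrowness of the quotient map makes the class of [y - v] smaller than [delta]; a lift [w] of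
    that class, still of norm below [delta], differs from [y - v] by the element [g] of [Z]. *)
Lemma rich_approx (W : normedModType F) (Z : closed_subspace W) (x y : W)
    (delta : R) (S : set W) :
  rich Z -> nrm x = 1 -> nrm y = 1 -> 0 < delta -> slice S -> S y ->
  exists (v : W) (g : normed_subspace Z),
    [/\ S v, 2 - delta < nrm (x + v) & nrm (v - y - (g : W)) < delta].
Proof.
move=> rZ x1 y1 d0 sS Sy; have [v [Sv xv qv]] := rZ _ _ x1 y1 _ d0 _ sS Sy.
have e0 : 0 < delta - nrm (quotient_map Z (y - v)) by rewrite subr_gt0.
have [w wq wd] := quotient_nrm_lt (quotient_map Z (y - v)) e0.
have /asboolP Zg : cs_set Z (w - (y - v)) by exact/quotient_mapE.
exists v, (NormedSubspace Zg); split => //=.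
rewrite [X in nrm X](_ : _ = - w); last first.
  by rewrite opprD opprB addrC subrK.
rewrite nrmN (lt_le_trans wd)// (_ : quotient_nrm _ = nrm (quotient_map Z (y - v))) ?subrKC//.
by rewrite nrm_quotient.
Qed.

End rich_subspaces.

(** * Norm estimates for scalar bumps *)

Section bumps.
Context {R : realType} {k : scalar_kind} {K : compactHausdorffType}.
Local Notation F := (scalars R k).
Local Notation CK := (contfun K F^o).

Lemma nrm_bump (s : K -> R) (cs : continuous s) (t0 : K) :
  (forall t, 0 <= s t <= 1) -> s t0 = 1 ->
  nrm (rmul cs (cst_contfun (1 : F^o))) = 1.
Proof.
move=> s01 st0; have E t : nrm (rmul cs (cst_contfun (1 : F^o)) t) = s t.
  rewrite /= nrmZ_ofR -ofR1 nrm_ofR normr1 mulr1 ger0_norm//.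
  by have /andP[] := s01 t.
apply/le_anti/andP; split.
  by apply: nrm_contfun_le => // t; rewrite E; have /andP[] := s01 t.
by rewrite -st0 -E nrm_apply_le.
Qed.

Lemma continuous_1sub (s : K -> R) : continuous s -> continuous (fun t => 1 - s t).
Proof. by move=> cs t; apply: cvgB; [exact: cvg_cst|exact: cs]. Qed.

(** Pointwise a convex combination of [v] and [-1], equal to [-1] at [t0]; it serves as the unit
    vector [y] in [staircase_step]. *)
Lemma nrm_bump_interpolation (s : K -> R) (cs : continuous s) (t0 : K) (v : CK) :
  (forall t, 0 <= s t <= 1) -> s t0 = 1 -> nrm v <= 1 ->
  nrm (rmul (continuous_1sub cs) v - rmul cs (cst_contfun (1 : F^o))) = 1.
Proof.
move=> s01 st0 v1; apply/le_anti/andP; split.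
  apply: nrm_contfun_le => // t; have /andP[s0 s1] := s01 t.
  rewrite contfunD contfunN !rmulE (le_trans (ler_nrmB _ _))// !nrmZ_ofR.
  rewrite -ofR1 nrm_ofR normr1 !ger0_norm ?subr_ge0// mulr1.
  have := le_trans (nrm_apply_le v t) v1.
  nra.
rewrite (le_trans _ (nrm_apply_le _ t0))//.
rewrite contfunD contfunN !rmulE st0 subrr ofR0 scale0r add0r nrmN nrmZ_ofR.
by rewrite -ofR1 nrm_ofR normr1 mulr1.
Qed.

(** Here [a], [b], [c] stand for the norms of [z], [1 + z], [z - 1]. Since [1 - s < d], one gets
    [b > 2 - 2 d], and the parallelogram law leaves [c ^ 2 <= 4 - (2 - 2 d) ^ 2 <= 8 d < h ^ 2]. *)
Lemma near1_arith (s h d a b c : R) : s <= 1 -> a <= 1 -> 0 <= a ->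
  d <= 1 -> 8 * d < h ^+ 2 -> d <= h -> 0 < h ->
  2 - d < s + a -> 2 - d < b + (1 - s) -> b ^+ 2 + c ^+ 2 = 2 + 2 * a ^+ 2 ->
  1 - h < s /\ c < h.
Proof.
move=> s1 a1 a0 d1 dh dh' h0 sa sb E; split; first by lra.
rewrite ltNge; apply/negP => hc.
have b1 : 2 - 2 * d < b by lra.
nra.
Qed.

Lemma near1_of_nrm_add (s h : R) (z : F^o) (d : R) : 0 <= s <= 1 -> nrm z <= 1 ->
  d <= 1 -> 8 * d < h ^+ 2 -> d <= h -> 0 < h ->
  2 - d < nrm (ofR s *: (1 : F^o) + z) ->
  1 - h < s /\ nrm (z - (1 : F^o)) < h.
Proof.
move=> /andP[s0 s1] z1 d1 dh dh' h0 H.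
have n1 : nrm (1 : F^o) = 1 by rewrite -ofR1 nrm_ofR normr1.
have n2 : nrm (ofR s *: (1 : F^o) + z) <= s + nrm z.
  by rewrite (le_trans (ler_nrmD _ _))// nrmZ_ofR n1 mulr1 ger0_norm.
have n3 : nrm (ofR s *: (1 : F^o) + z) <= nrm ((1 : F^o) + z) + (1 - s).
  have -> : ofR s *: (1 : F^o) + z = ((1 : F^o) + z) - ofR (1 - s) *: (1 : F^o).
    by change (ofR s * 1 + z = 1 + z - ofR (1 - s) * 1 :> F); rewrite ofRB ofR1; ring.
  by rewrite (le_trans (ler_nrmB _ _))// nrmZ_ofR n1 mulr1 ger0_norm// subr_ge0.
exact: (near1_arith s1 z1 (nrm_ge0 _) d1 dh dh' h0 (lt_le_trans H n2)
  (lt_le_trans H n3) (nrm_parallelogram1 z)).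
Qed.

End bumps.

(** * Almost nonnegative bumps in a rich subspace *)

Section narrow_bumps.
Context {R : realType} {k : scalar_kind} {K : compactHausdorffType}.
Local Notation F := (scalars R k).
Local Notation CK := (contfun K F^o).
Variable X : closed_subspace CK.
Hypothesis rX : rich X.

(* Richness is applied to [x = s] and [y = (1 - s) v - s]: the resulting [v'] is
   close to [1] where [s] is close to [1], while [v' - y] is [v' - v + 2 s] up
   to the error [s (v - 1)], which is small since [v] is close to [1] on [V]. *)
Lemma staircase_step (V : set K) (v : CK) (h : R) : open V -> V !=set0 ->
  nrm v <= 1 -> (forall t, V t -> nrm (v t - (1 : F^o)) <= h) -> 0 < h -> h <= 1 ->
  exists (V' : set K) (v' : CK) (s : K -> R) (g : normed_subspace X),
  [/\ [/\ open V', V' !=set0, V' `<=` V & nrm v' <= 1],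
    continuous s,
    (forall t, 0 <= s t <= 1) /\ (forall t, ~ V t -> s t = 0),
    (forall t, V' t -> 1 - h < s t /\ nrm (v' t - (1 : F^o)) < h) &
    (forall t, nrm (subval g t - (v' t - v t + ofR (2 * s t) *: (1 : F^o))) <= 2 * h)].
Proof.
move=> oV [t0 Vt0] v1 vV h0 h1.
have [s [cs s01 st0 sV]] := urysohn_bump (R := R) oV Vt0.
pose d := Num.min 1 (Num.min h (h ^+ 2 / 16)).
have h2 : 0 < h ^+ 2 by rewrite exprn_gt0.
have [d0 d1 dh dhh] : [/\ 0 < d, d <= 1, d <= h & 8 * d < h ^+ 2].
  have H : d <= h ^+ 2 / 16 by rewrite !ge_min lexx !orbT.
  split; last by lra.
  - by rewrite !lt_min ltr01 h0/= divr_gt0.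
  - by rewrite ge_min lexx.
  - by rewrite !ge_min lexx orbT.
have x1 := nrm_bump (k := k) cs s01 st0.
have y1 := nrm_bump_interpolation cs s01 st0 v1.
have [|v' [g [v'1 xv' gd]]] := rich_approx rX x1 y1 d0 (slice_ball _).
  by rewrite /= y1.
have [|t1 Ht1] := nrm_contfun_gt _ xv'; first by lra.
have v't t : nrm (v' t) <= 1 := le_trans (nrm_apply_le v' t) v'1.
have [st1 vt1] := near1_of_nrm_add (s01 t1) (v't t1) d1 dhh dh h0 Ht1.
(* The new set keeps the points of [V] where [s] and [v'] are both close to [1]. The point [t1] lies
   in [V] because [s] vanishes off [V] while [s t1 > 1 - h >= 0]. *)
exists (V `&` (s @^-1` [set a | 1 - h < a] `&` [set t | nrm (v' t - (1 : F^o)) < h])).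
exists v', s, g; split=> //.
- split=> //.
  + apply: openI => //; apply: openI; last exact: open_nrm_lt.
    by apply: open_comp; [move=> ? _; exact: cs | exact: open_gt].
  + exists t1; split=> //; apply: contrapT => /sV st10; move: st1.
    by rewrite st10 ltNge subr_ge0 h1.
- by move=> t [_ []].
move=> t.
have -> : subval g t - (v' t - v t + ofR (2 * s t) *: (1 : F^o)) =
   - (v' - (rmul (continuous_1sub cs) v - rmul cs (cst_contfun (1 : F^o))) - subval g) t
   + ofR (s t) *: (v t - 1).
  rewrite !contfunD !contfunN !contfunD !contfunN !rmulE.
  have -> : 2 * s t = s t + s t by ring.
  rewrite ofRB ofRD ofR1 /=.
  set a := subval g t; set b := v' t; set c := v t; set e := ofR _.
  by change (a - (b - c + (e + e) * 1) = - (b - ((1 - e) * c - e * 1) - a) + e * (c - 1) :> F); ring.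
rewrite (le_trans (ler_nrmD _ _))// nrmN.
have n1 := le_trans (nrm_apply_le _ t) (ltW gd).
have n2 : nrm (ofR (s t) *: (v t - 1)) <= h.
  rewrite nrmZ_ofR; have [/vV Vt|/sV ->] := pselect (V t); last first.
    by rewrite normr0 mul0r ltW.
  have /andP[s0 s1] := s01 t; rewrite ger0_norm//.
  by rewrite (le_trans (ler_piMl (nrm_ge0 _) s1)).
by rewrite (le_trans (lerD n1 n2))// mulr2n mulrDl mul1r lerD2r.
Qed.

(* The increments [v' - v] telescope, so that after [n] steps the sum of the [g]
   differs from [2 sg] by a bounded amount only, whereas [sg] reaches [n]. *)
Lemma staircase (U : set K) (h : R) (n : nat) : open U -> U !=set0 -> 0 < h -> h <= 1 ->
  exists (V : set K) (v : CK) (sg : K -> R) (psi : normed_subspace X),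
  [/\ [/\ open V, V !=set0, V `<=` U & nrm v <= 1],
    forall t, V t -> nrm (v t - (1 : F^o)) <= h,
    continuous sg /\ (forall t, 0 <= sg t <= n%:R),
    (forall t, ~ U t -> sg t = 0) /\ (forall t, V t -> n%:R * (1 - h) <= sg t) &
    (forall t, nrm (subval psi t - (v t - 1 + ofR (2 * sg t) *: (1 : F^o))) <=
       n%:R * (2 * h))].
Proof.
move=> oU U0 h0 h1; elim: n => [|n [V [v [sg [psi [[oV V0 VU v1] vV [csg sg0] [sgU sgV] Hp]]]]]].
  exists U, (cst_contfun (1 : F^o)), (fun=> 0), 0; split.
  - split=> //; apply: nrm_contfun_le => // t.
    by rewrite /= -ofR1 nrm_ofR normr1.
  - by move=> t _; rewrite /= subrr nrm0 ltW.
  - by split=> t; [exact: cvg_cst | rewrite lexx].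
  - by split=> t //; rewrite mul0r.
  - by move=> t; rewrite /= subrr mulr0 ofR0 scale0r addr0 subrr nrm0 mul0r.
have [V' [v' [s [g [[oV' V'0 V'V v'1] cs [s01 sV] V's Hg]]]]] :=
  staircase_step oV V0 v1 vV h0 h1.
exists V', v', (fun t => sg t + s t), (psi + g); split.
- by split=> //; exact: subset_trans VU.
- by move=> t /V's[_ /ltW].
- split=> t; first by apply: cvgD; [exact: csg|exact: cs].
  have /andP[s0 s1] := s01 t; have /andP[g0 g1] := sg0 t.
  by rewrite addr_ge0//= -natr1 lerD.
- split=> t.
    move=> nUt; rewrite sgU// sV ?addr0//; by move=> /VU.
  move=> Vt; rewrite -natr1 mulrDl mul1r lerD//; first exact/sgV/V'V.
  by have [/ltW] := V's _ Vt.
move=> t; have -> : n.+1%:R * (2 * h) = n%:R * (2 * h) + 2 * h by rewrite -(natr1 n) mulrDl mul1r.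
rewrite (le_trans _ (lerD (Hp t) (Hg t)))// (le_trans _ (ler_nrmD _ _))//.
rewrite le_eqVlt; apply/orP; left; apply/eqP; congr nrm.
have -> : 2 * (sg t + s t) = 2 * sg t + 2 * s t by ring.
rewrite ofRD subvalD contfunD.
set a := subval psi t; set b := subval g t; set c := v' t; set d := v t.
set e := ofR (_ * sg t); set f := ofR _.
by change (a + b - (c - 1 + (e + f) * 1) = a - (d - 1 + e * 1) + (b - (c - d + f * 1)) :> F); ring.
Qed.

End narrow_bumps.

(** * Bumps almost in [X], and absence of isolated points in [K] *)

Section rich_ck.
Context {R : realType} {k : scalar_kind} {K : compactHausdorffType}.
Local Notation F := (scalars R k).
Local Notation CK := (contfun K F^o).
Variable X : closed_subspace CK.
Hypothesis rX : rich X.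

(** Divide a staircase of [n] steps by [2 n]: the telescoped term [v - 1], of norm at most [2],
    contributes [1 / n] and the accumulated errors contribute [h], each at most [eps / 2]. *)
Lemma narrow_bump (U : set K) (eps : R) : open U -> U !=set0 -> 0 < eps ->
  exists (p : K -> R) (cp : continuous p) (psi : normed_subspace X),
  [/\ forall t, 0 <= p t <= 1, forall t, ~ U t -> p t = 0,
    exists2 t, U t & 1 - eps < p t &
    nrm (subval psi - rmul cp (cst_contfun (1 : F^o))) <= eps].
Proof.
move=> oU U0 e0.
pose h := Num.min 1 (eps / 2).
have h0 : 0 < h by rewrite lt_min ltr01 divr_gt0.
have h1 : h <= 1 by rewrite ge_min lexx.
have he : h <= eps / 2 by rewrite ge_min lexx orbT.
have [n n0 ne] : exists2 n : nat, 0 < n%:R :> R & 1 <= n%:R * (eps / 2).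
  exists (Num.truncn (2 / eps)).+1; first by rewrite ltr0Sn.
  by rewrite -ler_pdivrMr ?divr_gt0// mul1r invf_div ltW// truncnS_gt.
have [V [v [sg [psi [[oV [t1 Vt1] VU v1] vV [csg sg0] [sgU sgV] Hp]]]]] :=
  staircase rX n oU U0 h0 h1.
have cp : continuous (fun t => n%:R^-1 * sg t).
  by move=> t; apply: cvgM; [exact: cvg_cst|exact: csg].
exists _, cp, (ofR (2 * n%:R)^-1 *: psi); split.
- move=> t; have /andP[s0 s1] := sg0 t.
  by rewrite mulr_ge0 ?invr_ge0 ?(ltW n0)//= mulrC ler_pdivrMr// mul1r.
- by move=> t /sgU ->; rewrite mulr0.
- exists t1; first exact: VU.
  rewrite mulrC ltr_pdivlMr// mulrC (lt_le_trans _ (sgV _ Vt1))//.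
  by rewrite ltr_pM2l// ltrD2l ltrN2 (le_lt_trans he)// ltr_pdivrMr// ltr_pMr// ltr1n.
have csg2 : continuous (fun t => 2 * sg t).
  by move=> t; apply: cvgM; [exact: cvg_cst|exact: csg].
have -> : rmul cp (cst_contfun (1 : F^o)) =
    ofR (2 * n%:R)^-1 *: rmul csg2 (cst_contfun (1 : F^o)).
  apply: contfun_eq => t; rewrite contfunZ !rmulE scalerA -ofRM; congr (ofR _ *: _).
  by field; rewrite gt_eqF.
rewrite nrm_subvalZB ger0_norm ?invr_ge0 ?mulr_ge0 ?(ltW n0)//.
rewrite mulrC ler_pdivrMr ?mulr_gt0//.
apply: nrm_contfun_le => [|t]; first by rewrite !mulr_ge0// ?ltW.
have n1 : nrm (v t - (1 : F^o)) <= 2.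
  rewrite (le_trans (ler_nrmB _ _))// lerD//; first exact: le_trans (nrm_apply_le _ _) v1.
  by rewrite -ofR1 nrm_ofR normr1.
rewrite contfunD contfunN rmulE.
rewrite (le_trans (ler_dist_nrm _ (v t - 1)))//.
rewrite -addrA -opprD (addrC _ (v t - 1)) (le_trans (lerD n1 (Hp t)))//.
nra.
Qed.

Definition eval_at (t : K) (f : CK) : F^o := f t.

Lemma eval_at_linear t : linear (eval_at t).
Proof. by []. Qed.

HB.instance Definition _ t :=
  GRing.isLinear.Build F CK F^o *:%R (eval_at t) (eval_at_linear t).

Lemma eval_at_continuous t : continuous (eval_at t).
Proof.
apply/linear_bounded_continuous/linear_boundedP; near=> r => f.
have fr : `|eval_at t f| <= `|f|.
  by rewrite !Defs.normrE ler_ofR nrm_apply_le.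
by rewrite (le_trans fr)// ler_peMl//; near: r; apply: nbhs_pinfty_ge; rewrite num_real.
Unshelve. all: by end_near. Qed.

(* If [t0] were isolated, a function [v] with real part above [1/2] at [t0] could
   not be almost at distance [2] from the indicator function of [t0]. *)
Lemma rich_perfect (t0 : K) : ~ open [set t0].
Proof.
move=> o0; have [s [cs s01 st0 sV]] := urysohn_bump (R := R) o0 erefl.
have x1 := nrm_bump (k := k) cs s01 st0.
have y1 : nrm (cst_contfun (1 : F^o) : CK) = 1.
  by rewrite (nrm_cst_contfun _ t0) -ofR1 nrm_ofR normr1.
have x1' : nrm (- rmul cs (cst_contfun (1 : F^o))) = 1 by rewrite nrmN.
have sS : slice [set w : CK | nrm w <= 1 /\ 1 / 2 < re (eval_at t0 w)].
  split; last by exists (eval_at t0), (1 / 2); split=> //; exact: eval_at_continuous.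
  exists (cst_contfun (1 : F^o)); split; first by rewrite y1.
  by rewrite /eval_at /= -ofR1 ofRK ltr_pdivrMr// mul1r ltr1n.
have [||v [g [[v1 vt0] xv _]]] := rich_approx rX x1' y1 (_ : 0 < 1 / 2) sS.
- by rewrite divr_gt0.
- split; first by rewrite y1.
  by rewrite /eval_at /= -ofR1 ofRK ltr_pdivrMr// mul1r ltr1n.
have [|t] := nrm_contfun_gt _ xv; first by lra.
have vt : nrm (v t) <= 1 := le_trans (nrm_apply_le v t) v1.
rewrite contfunD contfunN rmulE => H.
have [tt0|/sV st] := pselect ([set t0] t); last first.
  move: H; rewrite st ofR0 scale0r oppr0 add0r; lra.
move: H vt; rewrite tt0 st0 ofR1 scale1r [- _ + _]addrC /= => H vt.
(* The squared norm of [v t0 - 1] is [1 + nrm (v t0) ^+ 2 - 2 * re (v t0)], hence below [1] by the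
   slice condition, whereas [H] puts this norm above [3 / 2]. *)
have := nrm_parallelogram1 (v t0); rewrite nrm_add1_sqr => E.
have c0 := nrm_ge0 (v t0 - (1 : F^o)).
have b0 := nrm_ge0 (v t0).
move: (re _) (nrm (v t0)) (nrm _) vt0 E H vt b0 c0 => a b c.
by clear=> a2 E cg b1 b0 c0; nra.
Qed.

(** As [K] has no isolated point, [U] has two points, which the Hausdorff property separates;
    iterating this provides disjoint supports. *)
Lemma rich_split (U : set K) : open U -> U !=set0 ->
  exists A B : set K, [/\ open A, open B, A !=set0, B !=set0 &
    [/\ A `<=` U, B `<=` U & forall t, A t -> ~ B t]].
Proof.
move=> oU [t0 Ut0].
have [t1 Ut1 t01] : exists2 t1, U t1 & t0 != t1.
  apply: contrapT => H; apply: (@rich_perfect t0).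
  suff <- : U = [set t0] by [].
  apply/seteqP; split=> [t Ut|_ ->//] /=.
  apply: contrapT => /eqP tt0; apply: H; exists t => //.
  by rewrite eq_sym.
have := @hausdorffT K; rewrite open_hausdorff => /(_ _ _ t01).
move=> [[A B]] /= [/set_mem At0 /set_mem Bt1] [oA oB /eqP AB].
exists (A `&` U), (B `&` U); split.
- exact: openI.
- exact: openI.
- by exists t0.
- by exists t1.
split=> [t []|t []|t [At _] [Bt _]]//.
by have : (A `&` B) t by []; rewrite AB.
Qed.

End rich_ck.

(** * Bumps almost in the kernel of a bounded map of rank at most one *)

Section functional.
Context {R : realType} {k : scalar_kind} {K : compactHausdorffType}.
Local Notation F := (scalars R k).
Local Notation CK := (contfun K F^o).
Variable X : closed_subspace CK.
Hypothesis rX : rich X.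
(** Values on a line of a normed module, rather than scalars, let [L] be built either from a slice
    functional or from a rank-one operator. *)
Variables (V : normedModType F) (L : normed_subspace X -> V) (w0 : V) (C : R).
Hypothesis L_linear : forall a f g, L (a *: f + g) = a *: L f + L g.
Hypothesis L_line : forall f, exists z : F, L f = z *: w0.
Hypothesis L_bounded : forall f, nrm (L f) <= C * nrm f.

(** Rotated bumps have nonnegative coefficients along [w0], so these add up without cancellation. *)
Lemma unit_rotation (z : F) : exists u : F, re `|u| = 1 /\ u * z = ofR (re `|z|).
Proof.
have [->|z0] := eqVneq z 0.
  by exists 1; rewrite normr1 mulr0 normr0 re0 ofR0 -[X in re X]ofR1 ofRK.
exists (`|z| / z); rewrite normf_div normr_id divff ?normr_eq0//.
by rewrite -[X in re X]ofR1 ofRK divfK// re_ofR.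
Qed.

(* If no bump made [L psi] small, bumps with disjoint supports, rotated so that
   the values of [L] add up, would contradict the boundedness of [L]. *)
Lemma aligned_disjoint_bumps (U : set K) (eps c : R) (n : nat) : 0 < eps ->
  (forall (p : K -> R) (cp : continuous p) (psi : normed_subspace X),
    (forall t, 0 <= p t <= 1) -> (forall t, ~ U t -> p t = 0) ->
    (exists2 t, U t & 1 - eps < p t) ->
    nrm (subval psi - rmul cp (cst_contfun (1 : F^o))) <= eps ->
    c <= nrm (L psi)) ->
  forall (U' : set K) (e : R), open U' -> U' !=set0 -> U' `<=` U -> 0 < e ->
  exists (psi : normed_subspace X) (a : R) (q : CK),
    [/\ L psi = ofR a *: w0, n%:R * c <= a * nrm w0,
      forall t, ~ U' t -> q t = 0, nrm q <= 1 & nrm (subval psi - q) <= e].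
Proof.
move=> eps0 H; elim: n => [|n IH] U' e oU' U'0 U'U e0.
  exists 0, 0, 0; split=> //.
  - have := L_linear 1 0 0; rewrite !scale1r addr0 ofR0 scale0r => /eqP.
    by rewrite -subr_eq0 opprD addrA subrr sub0r oppr_eq0 => /eqP.
  - by rewrite !mul0r.
  - by rewrite nrm0.
  - by rewrite (_ : subval 0 - 0 = 0) ?nrm0 ?ltW//; apply/subr0.
have [A [B [oA oB A0 B0 [AU BU AB]]]] := rich_split rX oU' U'0.
(* The induction hypothesis is spent inside [A], and one new bump is placed in [B]; the error [e] is
   shared equally. *)
have e2 : 0 < e / 2 by rewrite divr_gt0.
have [psi1 [a1 [q1 [L1 c1 q1A q11 pq1]]]] := IH A (e / 2) oA A0 (subset_trans AU U'U) e2.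
have m0 : 0 < Num.min eps (e / 2) by rewrite lt_min eps0.
have [p [cp [psi2 [p01 pB [t2 Bt2 pt2] pq2]]]] := narrow_bump rX oB B0 m0.
have c2 : c <= nrm (L psi2).
  apply: (H p cp) => //.
  - by move=> t nUt; apply: pB => /BU/U'U.
  - exists t2; first exact/U'U/BU.
    by rewrite (le_lt_trans _ pt2)// lerD2l lerN2 ge_min lexx.
  - by rewrite (le_trans pq2)// ge_min lexx.
have [z Lz] := L_line psi2.
have [u [u1 uz]] := unit_rotation z.
exists (u *: psi2 + psi1), (re `|z| + a1), (u *: rmul cp (cst_contfun (1 : F^o)) + q1).
have ut t : ~ B t -> (u *: rmul cp (cst_contfun (1 : F^o)) + q1) t = q1 t.
  by move=> /pB pt; rewrite contfunD contfunZ rmulE pt ofR0 scale0r scaler0 add0r.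
split.
- by rewrite L_linear L1 Lz scalerA uz -scalerDl ofRD.
- rewrite -(natr1 n) mulrDl mul1r mulrDl addrC lerD//.
  by rewrite -nrmZ -Lz.
- by move=> t nU't; rewrite ut ?q1A//; [move=> /AU|move=> /BU].
(* At each point at most one of the two summands is nonzero, so the sup norm does not grow. *)
- apply: nrm_contfun_le => // t; have [Bt|/ut->] := pselect (B t); last first.
    exact: le_trans (nrm_apply_le q1 t) q11.
  rewrite contfunD contfunZ rmulE q1A ?addr0; last by move=> /AB.
  have /andP[p0 p1] := p01 t.
  by rewrite nrmZ u1 mul1r nrmZ_ofR -ofR1 nrm_ofR normr1 mulr1 ger0_norm.
have -> : subval (u *: psi2 + psi1) - (u *: rmul cp (cst_contfun (1 : F^o)) + q1) =
   u *: (subval psi2 - rmul cp (cst_contfun (1 : F^o))) + (subval psi1 - q1).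
  by rewrite scalerBr addrACA -opprD.
rewrite (le_trans (ler_nrmD _ _))// nrmZ u1 mul1r [e]splitr lerD//.
by rewrite (le_trans pq2)// ge_min lexx orbT.
Qed.

Lemma narrow_bump_functional (U : set K) (eps c : R) :
  open U -> U !=set0 -> 0 < eps -> 0 < c ->
  exists (p : K -> R) (cp : continuous p) (psi : normed_subspace X),
  [/\ forall t, 0 <= p t <= 1, forall t, ~ U t -> p t = 0,
    exists2 t, U t & 1 - eps < p t,
    nrm (subval psi - rmul cp (cst_contfun (1 : F^o))) <= eps &
    nrm (L psi) < c].
Proof.
move=> oU U0 eps0 c0; apply: contrapT => N.
have H (p : K -> R) (cp : continuous p) (psi : normed_subspace X) :
    (forall t, 0 <= p t <= 1) -> (forall t, ~ U t -> p t = 0) ->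
    (exists2 t, U t & 1 - eps < p t) ->
    nrm (subval psi - rmul cp (cst_contfun (1 : F^o))) <= eps ->
    c <= nrm (L psi).
  move=> p01 pU pt pp; rewrite leNgt; apply/negP => Lc.
  by apply: N; exists p, cp, psi.
(* With this [n], the norm of [L psi] is at least [n c > 2 |C|], although [psi], being within [1] of
   [q], has norm at most [2]. *)
pose n := (Num.truncn (`|C| * 2 / c)).+1.
have nC : `|C| * 2 < n%:R * c by rewrite -ltr_pdivrMr// truncnS_gt.
have [psi [a [q [La na _ q1 pq]]]] := aligned_disjoint_bumps n eps0 H oU U0 (@subset_refl _ U) ltr01.
have psi2 : nrm psi <= 2.
  have -> : nrm psi = nrm (subval psi) by [].
  by rewrite (le_trans (ler_dist_nrm _ q))// lerD.
have := L_bounded psi; rewrite La nrmZ_ofR; apply/negP; rewrite -ltNge.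
apply: (@le_lt_trans _ _ (`|C| * 2)).
  by rewrite (le_trans (ler_wpM2r (nrm_ge0 _) (ler_norm C)))// ler_wpM2l.
by rewrite (lt_le_trans nC)// (le_trans na)// ler_wpM2r ?nrm_ge0// ler_norm.
Qed.

End functional.

(** The additive core of the pointwise identity in [tensor_approx], with [Y], [A], [B], [T], [P],
    [Q] standing for [y], [psi e], [psi y(t0)], [p y], [p e], [p y(t0)]. *)
Lemma zmod_rearrange (M : zmodType) (Y A B T P Q : M) :
  Y + (A - B) - (Y - T + P) = A - B - (P - Q) + (T - Q).
Proof.
have -> : A - B - (P - Q) + (T - Q) = (A - B) + (T - P).
  by rewrite opprB -[LHS]addrA; congr (_ + _); rewrite addrC addrA subrK.
by rewrite opprD opprB [LHS]addrC [T - Y - P]addrAC addrA subrK addrC.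
Qed.

(** * Vector-valued functions *)

Section vector_valued.
Context {R : realType} {k : scalar_kind} {K : compactHausdorffType}.
Local Notation F := (scalars R k).
Local Notation CK := (contfun K F^o).
Variable X : closed_subspace CK.
Hypothesis rX : rich X.
Variable E : normedModType F.

Lemma elem_tensorE (psi : CK) (e : E) t : elem_tensor psi e t = (psi t : F) *: e.
Proof. by []. Qed.

(** The vector [w = e - y(t0)] is produced before [L] is given, because the maps [L] to be
    controlled are themselves formed with [w]. Only the choice of the bump depends on [L]. *)
Lemma tensor_approx (x y : contfun K E) (delta : R) :
  nrm x = 1 -> nrm y <= 1 -> 0 < delta ->
  exists w : E, forall (V : normedModType F) (L : normed_subspace X -> V) (w0 : V) (C : R),
    (forall a f g, L (a *: f + g) = a *: L f + L g) ->
    (forall f, exists z : F, L f = z *: w0) ->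
    (forall f, nrm (L f) <= C * nrm f) ->
  exists (psi : normed_subspace X) (v : contfun K E),
  [/\ nrm v <= 1, 2 - delta < nrm (x + v),
    nrm (y + elem_tensor (subval psi) w - v) < delta & nrm (L psi) < delta].
Proof.
move=> x1 y1 d0.
(* The norm of [x + v] will lose at most [4 h] and the tensor approximation at most [3 h], both
   below [delta]. *)
pose h := Num.min 1 (delta / 8).
have h0 : 0 < h by rewrite lt_min ltr01 divr_gt0.
have h1 : h <= 1 by rewrite ge_min lexx.
have hd : h <= delta / 8 by rewrite ge_min lexx orbT.
have [||t0 xt0] := @nrm_contfun_gt _ _ _ _ x (1 - h).
- by rewrite subr_ge0.
- by rewrite x1 ltrBlDr ltrDl.
have xt0' : nrm (x t0) <= 1 by rewrite -x1 nrm_apply_le.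
have [e e1 xe] : exists2 e : E, nrm e = 1 & nrm (x t0 - e) <= h.
  have [x0|x0] := eqVneq (nrm (x t0)) 0.
    have h1' : 1 < h by rewrite x0 in xt0; rewrite -subr_lt0.
    by move: h1; rewrite leNgt h1'.
  have xp : 0 < nrm (x t0) by rewrite lt_def x0 nrm_ge0.
  exists (ofR (nrm (x t0))^-1 *: x t0).
    by rewrite nrmZ_ofR ger0_norm ?invr_ge0 ?nrm_ge0// mulVf.
  rewrite -{1}[x t0]scale1r -ofR1 -scalerBl -ofRB nrmZ_ofR.
  rewrite ler0_norm ?subr_le0 ?invf_ge1// opprB mulrBl mulVf// mul1r.
  by rewrite lerBlDr -lerBlDl ltW.
exists (e - y t0) => V L w0 C Ll Lz Lb.
pose U := [set t | nrm (x t - x t0) < h] `&` [set t | nrm (y t - y t0) < h].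
have oU : open U by apply: openI; exact: open_nrm_lt.
have U0 : U !=set0 by exists t0; split; rewrite /= subrr nrm0.
have [p [cp [psi [p01 pU [t1 Ut1 pt1] pp Lp]]]] :=
  narrow_bump_functional rX Ll Lz Lb oU U0 h0 d0.
have yt t : nrm (y t) <= 1 := le_trans (nrm_apply_le y t) y1.
have w2 : nrm (e - y t0) <= 2.
  by rewrite (le_trans (ler_nrmB _ _))// lerD// e1.
exists psi, (rmul (continuous_1sub cp) y + rmul cp (cst_contfun e)); split=> //.
- apply: nrm_contfun_le => // t; have /andP[p0 p1] := p01 t.
  rewrite contfunD !rmulE (le_trans (ler_nrmD _ _))// !nrmZ_ofR e1 mulr1.
  rewrite !ger0_norm ?subr_ge0//.
  by rewrite -lerBrDr ler_piMr// subr_ge0.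
(* At [t1] the bump exceeds [1 - h], so [v] is within [2 h] of [e]; so is [x], and [e + e] has norm
   [2]. *)
- have [Ux Uy] := Ut1; have /andP[p0 p1] := p01 t1.
  rewrite (lt_le_trans _ (nrm_apply_le _ t1))// !contfunD !rmulE /=.
  have ve : nrm (ofR (1 - p t1) *: y t1 + ofR (p t1) *: e - e) <= h * 2.
    have -> : ofR (1 - p t1) *: y t1 + ofR (p t1) *: e - e = ofR (1 - p t1) *: (y t1 - e).
      by rewrite scalerBr ofRB ofR1 [in X in _ = _ - X]scalerBl scale1r opprB addrA.
    rewrite nrmZ_ofR ger0_norm ?subr_ge0// ler_pM ?subr_ge0 ?nrm_ge0//.
      by rewrite lerBlDr -lerBlDl ltW.
    by rewrite (le_trans (ler_nrmB _ _))// lerD ?e1.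
  have xe1 : nrm (x t1 - e) <= h + h.
    have -> : x t1 - e = (x t1 - x t0) + (x t0 - e) by rewrite addrA subrK.
    by rewrite (le_trans (ler_nrmD _ _))// lerD// ltW.
  set v := _ + _ *: e in ve *.
  have : nrm (e + e) <= nrm (x t1 + v) + (nrm (x t1 - e) + nrm (v - e)).
    rewrite (le_trans (ler_dist_nrm (e + e) (x t1 + v)))// lerD2l.
    by rewrite -nrmN opprB opprD addrACA ler_nrmD.
  have -> : nrm (e + e) = 2.
    have -> : e + e = ofR 2 *: e by rewrite ofRD ofR1 scalerDl scale1r.
    by rewrite nrmZ_ofR e1 mulr1 ger0_norm.
  move: (nrm (x t1 + v)) (nrm (_ - e)) (nrm (v - e)) xe1 ve => a b c.
  by clear -d0 hd; lra.
- apply: (@le_lt_trans _ _ (h * 2 + h)); last by lra.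
  apply: nrm_contfun_le => [|t]; first by rewrite addr_ge0 ?mulr_ge0 ?ltW.
  rewrite !contfunD !contfunN !contfunD !rmulE elem_tensorE /=.
  (* The first error is small since [psi] is close to [p]; the second since [y] is almost constant
     on [U] and [p] vanishes off [U]. *)
  have -> : y t + subval psi t *: (e - y t0) - (ofR (1 - p t) *: y t + ofR (p t) *: e) =
     (subval psi t - ofR (p t) *: (1 : F^o) : F) *: (e - y t0) + ofR (p t) *: (y t - y t0).
    have -> : ofR (p t) *: (1 : F^o) = ofR (p t) :> F by rewrite /= /GRing.scale /= mulr1.
    rewrite ofRB ofR1 !scalerBl scale1r !scalerBr.
    exact: zmod_rearrange.
  rewrite (le_trans (ler_nrmD _ _))// lerD//.
    rewrite nrmZ; apply: ler_pM => //; try exact: nrm_ge0.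
    exact: le_trans (nrm_apply_le _ t) pp.
  rewrite nrmZ_ofR; have [[_ /ltW Uy]|/pU ->] := pselect (U t); last first.
    by rewrite normr0 mul0r ltW.
  have /andP[p0 p1] := p01 t.
  by rewrite ger0_norm// (le_trans (ler_piMl (nrm_ge0 _) p1)).
Qed.

End vector_valued.

(** * Operator norm of a bounded homogeneous map *)

Section opnorm.
Context {R : realType} {k : scalar_kind} {V W : normedModType (scalars R k)}.
Variables (T : V -> W) (C : R).
Hypothesis TZ : forall a v, T (a *: v) = a *: T v.
Hypothesis TC : forall v, nrm (T v) <= C * nrm v.

Lemma opnorm_set_bounded : has_sup [set nrm (T v) | v in [set v : V | nrm v <= 1]].
Proof.
split; first by exists (nrm (T 0)), 0 => //=; rewrite nrm0.
exists `|C| => _ [v /= v1 <-]; rewrite (le_trans (TC v))//.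
by rewrite (le_trans (ler_wpM2r (nrm_ge0 _) (ler_norm C)))// ler_piMr.
Qed.

Lemma nrm_le_opnorm v : nrm (T v) <= opnorm T * nrm v.
Proof.
have [->|v0] := eqVneq v 0; first by rewrite -(scale0r 0) TZ !nrmZ normr0 re0 !mul0r mulr0.
have vp : 0 < nrm v by rewrite nrm_gt0.
rewrite -ler_pdivrMr// mulrC.
have -> : (nrm v)^-1 * nrm (T v) = nrm (T (ofR (nrm v)^-1 *: v)).
  by rewrite TZ nrmZ_ofR ger0_norm ?invr_ge0 ?nrm_ge0.
apply: ub_le_sup; first by have [] := opnorm_set_bounded.
exists (ofR (nrm v)^-1 *: v) => //=.
by rewrite nrmZ_ofR ger0_norm ?invr_ge0 ?nrm_ge0// mulVf ?gt_eqF.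
Qed.

Lemma opnorm_le (M : R) : (forall v, nrm v <= 1 -> nrm (T v) <= M) -> opnorm T <= M.
Proof.
move=> TM; apply: ge_sup; first by have [] := opnorm_set_bounded.
by move=> _ [v v1 <-]; exact: TM.
Qed.

Lemma opnorm_adherent (e : R) : 0 < e ->
  exists2 v, nrm v <= 1 & opnorm T - e < nrm (T v).
Proof. by move=> e0; have [_ [v v1 <-] Tv] := sup_adherent e0 opnorm_set_bounded; exists v. Qed.

End opnorm.

(** * Richness and the Daugavet property of the injective tensor product *)

Section tensor.
Context {R : realType} {k : scalar_kind} {K : compactHausdorffType}.
Local Notation F := (scalars R k).
Local Notation CK := (contfun K F^o).
Variables (X : closed_subspace CK) (E : normedModType F).

Lemma elem_tensor_linear a (f g : CK) (w : E) :
  elem_tensor (a *: f + g) w = a *: elem_tensor f w + elem_tensor g w.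
Proof.
apply: contfun_eq => t; rewrite contfunD contfunZ !elem_tensorE.
by rewrite contfunD contfunZ scalerDl scalerA.
Qed.

Lemma nrm_elem_tensor (f : CK) (w : E) : nrm (elem_tensor f w) <= nrm w * nrm f.
Proof.
apply: nrm_contfun_le => [|t]; first by rewrite mulr_ge0 ?nrm_ge0.
by rewrite elem_tensorE nrmZ mulrC ler_wpM2l ?nrm_ge0// (nrm_apply_le f t).
Qed.

Lemma elem_tensor_mem (f : normed_subspace X) (w : E) :
  elem_tensor (subval f) w \in cs_pred (inj_tensor X E).
Proof.
apply/asboolP/subset_closure; exists [:: (1, elem_tensor (subval f) w)]; split.
  move=> p; rewrite inE => /eqP -> /=; exists (subval f), w; split=> //.
  exact/asboolP/(valP f).
by rewrite big_seq1 scale1r.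
Qed.

Definition sub_tensor (f : normed_subspace X) (w : E) :
  normed_subspace (inj_tensor X E) := NormedSubspace (elem_tensor_mem f w).

Hypothesis rX : rich X.

Lemma rich_inj_tensor : rich (inj_tensor X E).
Proof.
move=> x y x1 y1 delta d0 S [S0 [f [alpha [cf ->]]]] [_ fy].
have [C C0 fC] := continuous_linear_nrm cf.
(* Passing from [y] to [v] lowers the real part of [f] by less than [d] through the tensor and by at
   most [C * d] through the remainder [r]; this choice keeps [v] in the slice. *)
pose d := Num.min delta ((re (f y) - alpha) / (1 + C)).
have C1 : 0 < 1 + C by rewrite addr_gt0.
have dp : 0 < d by rewrite lt_min d0/= divr_gt0// subr_gt0.
have dd : d <= delta by rewrite ge_min lexx.
have df : d * (1 + C) <= re (f y) - alpha.
  by rewrite -ler_pdivlMr// ge_min lexx orbT.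
have y1' : nrm y <= 1 by rewrite y1.
have [w Hw] := tensor_approx rX x1 y1' dp.
have [|||psi [v [v1 xv yv Lp]]] := Hw F^o (fun g => f (elem_tensor (subval g) w)) 1 (C * nrm w).
- by move=> a g h; rewrite subvalD subvalZ elem_tensor_linear linearP.
- by move=> g; exists (f (elem_tensor (subval g) w)); rewrite /GRing.scale /= mulr1.
- move=> g; rewrite (le_trans (fC _))// -mulrA ler_wpM2l ?nrm_elem_tensor//.
  exact: ltW.
set r := y + _ - v in yv.
have vE : v = y + elem_tensor (subval psi) w - r by rewrite /r opprB addrC subrK.
exists v; split.
- split=> //; rewrite vE linearB linearD reD reN reD.
  have := le_lt_trans (re_le_nrm (- f (elem_tensor (subval psi) w))) (_ : _ < d).
  rewrite nrmN reN => /(_ Lp) H1.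
  have H2 := le_trans (re_le_nrm (f r)) (fC r).
  have H3 : C * nrm r <= C * d by rewrite ler_wpM2l ?ltW.
  move: (re (f (elem_tensor _ _))) (re (f r)) (nrm r) H1 H2 H3 => a b c.
  by clear -df; lra.
- by rewrite (le_lt_trans _ xv)// lerD2l lerN2.
(* [y - v] and [r] differ by an elementary tensor of the subspace, so they have the same class. *)
rewrite [X in nrm X](_ : _ = quotient_map (inj_tensor X E) r); last first.
  apply/quotient_mapE.
  rewrite /r opprB addrA subrK opprD addrA subrr sub0r.
  by apply/asboolP; rewrite -cs_predE rpredN elem_tensor_mem.
by rewrite nrm_quotient (le_lt_trans (quotient_nrm_le _ r))// (lt_le_trans yv).
Qed.

Lemma sub_tensor_linear (w : E) a f g :
  sub_tensor (a *: f + g) w = a *: sub_tensor f w + sub_tensor g w.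
Proof.
by apply: val_inj; exact: (elem_tensor_linear a (subval f) (subval g) w).
Qed.

(** Chaining the estimates gives [1 + l <= N + N d + 3 d + 3 l d]. With [N <= 1 + M] and [l <= M]
    the error is at most [d (4 + 4 M)], and replacing [l] by [M] costs one more [d], whence
    [5 + 4 M]. *)
Lemma daugavet_arith (N M l d eta a b p q : R) : 0 < d -> 0 < l -> l <= M ->
  M - d < l -> N <= 1 + M -> d * (5 + 4 * M) <= eta -> a <= 1 + d ->
  2 - 2 * d <= b -> q <= N * (1 + d) -> p <= q + d ->
  (1 + l) * b <= p + (l * a + 1) -> 1 + M <= N + eta.
Proof.
move=> d0 l0 lM Ml NM deta ad db qN pq bp.
have l1 : 0 <= 1 + l by lra.
have H1 := ler_wpM2l l1 db.
have H2 := ler_wpM2l (ltW l0) ad.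
have H3 := ler_wpM2l (ltW d0) NM.
have H4 := ler_wpM2l (ltW d0) lM.
lra.
Qed.

(** For [u] almost norming [T] and [x] the direction of [T u], [tensor_approx] moves [u] to some
    [v'] almost at distance [2] from [-x] while hardly changing the image under [T]; then
    [v' + T v'] has norm almost [1 + opnorm T]. *)
Lemma daugavet_inj_tensor : daugavet (normed_subspace (inj_tensor X E)).
Proof.
move=> T cT [w0 w00 rT].
have [C C0 TC] := continuous_linear_nrm cT.
pose S (w : normed_subspace (inj_tensor X E)) := w + T w.
have SC v : nrm (S v) <= (1 + C) * nrm v.
  by rewrite (le_trans (ler_nrmD _ _))// mulrDl mul1r lerD2l.
have TZ a v : T (a *: v) = a *: T v by rewrite linearZ.
have SZ a v : S (a *: v) = a *: S v by rewrite /S TZ scalerDr.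
set M := opnorm T; rewrite -/S; set N := opnorm S.
have M0 : 0 < M.
  have [u _ Tu] : range T w0 by rewrite rT; exists 1 => //; rewrite scale1r.
  have := nrm_le_opnorm TZ TC u; rewrite -/M Tu => /(lt_le_trans (_ : 0 < nrm w0)).
  rewrite nrm_gt0 w00 => /(_ isT); apply: contraTT; rewrite -!leNgt => M0.
  by rewrite mulr_le0_ge0 ?nrm_ge0.
have NM : N <= 1 + M.
  apply: (opnorm_le SC) => v v1; rewrite (le_trans (ler_nrmD _ _))// lerD//.
  by rewrite (le_trans (nrm_le_opnorm TZ TC v))// ler_piMr// ltW.
apply/le_anti; rewrite NM/=; apply/ler_addgt0Pr => eta eta0.
pose c := 5 + 4 * M.
have c0 : 0 < c by rewrite /c; lra.
(* The bound [M / 2] keeps [nrm (T u) > M - d] positive, so that [T u] can be normalized. *)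
pose d := Num.min (M / 2) (eta / c).
have d0 : 0 < d by rewrite lt_min !divr_gt0.
have dM : d <= M / 2 by rewrite ge_min lexx.
have dc : d * c <= eta by rewrite -ler_pdivlMr// ge_min lexx orbT.
have [u u1 Mu] := opnorm_adherent TC d0; rewrite -/M in Mu.
set l := nrm (T u) in Mu.
have l0 : 0 < l by lra.
have lM : l <= M.
  by rewrite (le_trans (nrm_le_opnorm TZ TC u))// ler_piMr// ltW.
pose x := ofR l^-1 *: T u.
have xl : T u = ofR l *: x by rewrite /x scalerA -ofRM divff ?gt_eqF// ofR1 scale1r.
have x1 : nrm x = 1.
  by rewrite /x nrmZ_ofR ger0_norm ?invr_ge0 ?nrm_ge0// mulVf ?gt_eqF.
have [w Hw] := tensor_approx rX (x1 : nrm (subval x) = 1) (u1 : nrm (subval u) <= 1) d0.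
have [|||psi [v [v1 xv uv Lp]]] := Hw _ (fun g => T (sub_tensor g w)) w0 (C * nrm w).
- by move=> a g h; rewrite sub_tensor_linear linearP.
- move=> g; have : range T (T (sub_tensor g w)) by exists (sub_tensor g w).
  by rewrite rT => -[a _ <-]; exists a.
- move=> g; rewrite (le_trans (TC _))// -mulrA ler_wpM2l//; first exact: ltW.
  exact: (nrm_elem_tensor (subval g) w).
(* Unlike [v], this element lies in the tensor product, where [T] is defined; it is within [d] of
   [v]. *)
pose v' := u + sub_tensor psi w.
have v'1 : nrm v' <= 1 + d.
  have : nrm (subval v') <= 1 + d; last by [].
  by rewrite (le_trans (ler_dist_nrm _ v))// lerD// ltW.
have xv' : 2 - 2 * d <= nrm (x + v').
  have H : nrm (subval x + v) <= nrm (subval x + subval v') + nrm (subval v' - v).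
    rewrite (le_trans (ler_dist_nrm _ (subval x + subval v')))// lerD2l.
    by rewrite -nrmN opprB opprD addrACA subrr add0r.
  have H' := lt_le_trans xv H.
  have -> : nrm (x + v') = nrm (subval x + subval v') by [].
  have uv' : nrm (subval v' - v) < d := uv.
  move: (nrm (subval x + subval v')) (nrm (subval v' - v)) H' uv' => a b.
  by clear; lra.
have Sv' : nrm (S v') <= N * (1 + d).
  rewrite (le_trans (nrm_le_opnorm SZ SC v'))// ler_wpM2l//.
  by rewrite (le_trans (nrm_ge0 (S x)))// (le_trans (nrm_le_opnorm SZ SC x))// x1 mulr1.
have S1 : nrm (v' + ofR l *: x) <= nrm (S v') + d.
  rewrite (le_trans (ler_dist_nrm _ (S v')))// lerD2l.
  have -> : S v' = v' + (ofR l *: x + T (sub_tensor psi w)) by rewrite -xl -linearD.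
  by rewrite opprD addrACA subrr add0r opprD addrA subrr sub0r nrmN ltW.
(* Splitting [(1 + l) (x + v')] as [(v' + l x) + (l v' + x)] transfers the near-maximal norm of
   [x + v'] to [v' + l x], since the other summand has norm at most about [1 + l]. *)
have S2 : (1 + l) * nrm (x + v') <= nrm (v' + ofR l *: x) + (l * nrm v' + 1).
  have -> : (1 + l) * nrm (x + v') = nrm (ofR (1 + l) *: (x + v')).
    by rewrite nrmZ_ofR ger0_norm// addr_ge0// ltW.
  have -> : ofR (1 + l) *: (x + v') = (v' + ofR l *: x) + (ofR l *: v' + x).
    by rewrite ofRD ofR1 scalerDl scale1r scalerDr [x + v']addrC addrACA [x + _]addrC.
  rewrite (le_trans (ler_nrmD _ _))// lerD2l (le_trans (ler_nrmD _ _))//.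
  by rewrite nrmZ_ofR x1 gtr0_norm.
exact: (daugavet_arith d0 l0 lM Mu NM dc v'1 xv' Sv' S1 S2).
Qed.

End tensor.

Theorem proposition4p1 (R : realType) (k : scalar_kind)
    (K : compactHausdorffType)
    (X : closed_subspace (contfun K (scalars R k)^o)) :
  rich X ->
  forall E : completeNormedModType (scalars R k),
    rich (inj_tensor X E) /\ daugavet (normed_subspace (inj_tensor X E)).
Proof.
by move=> rX E; split; [exact: rich_inj_tensor|exact: daugavet_inj_tensor].
Qed.
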